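(* Let $(X_1,\varphi_1)$ and $(X_2,\varphi_2)$ be Cantor minimal systems. The homeomorphisms $\varphi_1$ and $\varphi_2$ are orbit equivalent if and only if $D([\varphi_1])$ and $D([\varphi_2])$ are isomorphic as abstract groups.
   Context: A Cantor set is a (non-empty) zero-dimensional compact metric space without isolated points. $H(X)$ is the group of all homeomorphisms of $X$. A Cantor minimal system $(X,\varphi)$ is a Cantor set $X$ with $\varphi\in H(X)$ such that every orbit $Orb_\varphi(x)=\{\varphi^n(x):n\in\mathbb Z\}$ is dense in $X$. The full group $[\varphi]$ is the set of all $f\in H(X)$ with $f(x)\in Orb_\varphi(x)$ for all $x\in X$. For a group $G$, $D(G)$ is the commutator subgroup, generated by all $[f,g]=fgf^{-1}g^{-1}$ with $f,g\in G$. $(X_1,\varphi_1)$ and $(X_2,\varphi_2)$ are orbit equivalent if there is a homeomorphism $F:X_1\to X_2$ with $F(Orb_{\varphi_1}(x))=Orb_{\varphi_2}(F(x))$ for all $x\in X_1$. *)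

(* Defs.v *)
From HB Require Import structures.
From mathcomp Require Import all_boot all_order all_algebra.
From mathcomp Require Import boolp classical_sets functions reals topology.

Set Implicit Arguments.
Unset Strict Implicit.
Unset Printing Implicit Defensive.

Local Open Scope classical_set_scope.
Local Open Scope group_scope.

(* The library's [zero_dimensional] separates any two points by a clopen set;
   for compact metric spaces this is the existence of a clopen base. *)
Definition cantor_set (R : realType) (X : metricType R) : Prop :=
  [/\ [set: X] !=set0, zero_dimensional X, compact [set: X] &
      isolated [set: X] = set0].

Record homeo (X Y : topologicalType) := Homeo {
  homeo_fun :> X -> Y;
  homeo_inv : Y -> X;
  homeoK : cancel homeo_fun homeo_inv;
  homeo_invK : cancel homeo_inv homeo_fun;
  homeo_continuous : continuous homeo_fun;
  homeo_inv_continuous : continuous homeo_inv }.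

Arguments homeo_continuous {X Y} h.
Arguments homeo_inv_continuous {X Y} h.

HB.instance Definition _ (X Y : topologicalType) := gen_eqMixin (homeo X Y).
HB.instance Definition _ (X Y : topologicalType) := gen_choiceMixin (homeo X Y).

Lemma homeoP (X Y : topologicalType) (f g : homeo X Y) : f =1 g -> f = g.
Proof.
case: f g => [f f' fK f'K cf cf'] [g g' gK g'K cg cg'] /= /funext fg.
subst g.
have fg' : f' = g' by apply: funext => y; rewrite -{1}(g'K y) fK.
subst g'.
by congr Homeo; exact: Prop_irrelevance.
Qed.

Section homeo_group.
Context {X : topologicalType}.
Implicit Types f g : homeo X X.

Let id_continuous : continuous (id : X -> X). Proof. by move=> x. Qed.

Definition homeo_id : homeo X X :=
  Homeo (fun=> erefl) (fun=> erefl) id_continuous id_continuous.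

Definition homeo_sym f : homeo X X :=
  Homeo (homeo_invK f) (homeoK f) (homeo_inv_continuous f)
    (homeo_continuous f).

Lemma homeo_comp_continuous f g : continuous (f \o g).
Proof. by move=> x; apply: continuous_comp; exact: homeo_continuous. Qed.

Definition homeo_comp f g : homeo X X :=
  @Homeo X X (f \o g) (homeo_inv g \o homeo_inv f)
    (can_comp (homeoK f) (homeoK g))
    (can_comp (homeo_invK g) (homeo_invK f))
    (@homeo_comp_continuous f g)
    (@homeo_comp_continuous (homeo_sym g) (homeo_sym f)).

Let homeo_compA : associative homeo_comp.
Proof. by move=> f g h; exact: homeoP. Qed.

Let homeo_comp1f : left_id homeo_id homeo_comp.
Proof. by move=> f; exact: homeoP. Qed.

Let homeo_compf1 : right_id homeo_id homeo_comp.
Proof. by move=> f; exact: homeoP. Qed.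

Let homeo_compVf : left_inverse homeo_id homeo_sym homeo_comp.
Proof. by move=> f; apply: homeoP => x; exact: homeoK. Qed.

Let homeo_compfV : right_inverse homeo_id homeo_sym homeo_comp.
Proof. by move=> f; apply: homeoP => x; exact: homeo_invK. Qed.

HB.instance Definition _ := isGroup.Build (homeo X X)
  homeo_compA homeo_comp1f homeo_compf1 homeo_compVf homeo_compfV.

End homeo_group.

Definition zexpg (G : groupType) (g : G) (n : int) : G :=
  match n with Posz k => g ^+ k | Negz k => g ^- k.+1 end.

Definition homeo_orbit (X : topologicalType) (phi : homeo X X) (x : X) : set X :=
  [set zexpg phi n x | n in [set: int]].

Definition cantor_minimal_system (R : realType) (X : metricType R)
    (phi : homeo X X) : Prop :=
  cantor_set X /\ forall x : X, dense (homeo_orbit phi x).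

Definition full_group (X : topologicalType) (phi : homeo X X) :
    set (homeo X X) :=
  [set f | forall x : X, homeo_orbit phi x (f x)].

Definition orbit_equivalent (X1 X2 : topologicalType)
    (phi1 : homeo X1 X1) (phi2 : homeo X2 X2) : Prop :=
  exists F : homeo X1 X2,
    forall x : X1, F @` homeo_orbit phi1 x = homeo_orbit phi2 (F x).

Section subgroups.
Variable G : groupType.
Implicit Types A H : set G.

Definition subgroup H : Prop :=
  [/\ H 1, forall x y, H x -> H y -> H (x * y) & forall x, H x -> H x^-1].

Definition generated_subgroup A : set G := smallest subgroup A.

(* The library's [~ f, g] is f^-1 * g^-1 * f * g, a different convention. *)
Definition commutator_subgroup A : set G :=
  generated_subgroup [set f * g * f^-1 * g^-1 | f in A & g in A].

End subgroups.

(* Isomorphism of the groups carried by the subgroups H1 and H2; the values of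
   h outside H1 are irrelevant. *)
Definition isomorphic_subgroups (G1 G2 : groupType)
    (H1 : set G1) (H2 : set G2) : Prop :=
  exists h : G1 -> G2,
    set_bij H1 H2 h /\
    forall x y, H1 x -> H1 y -> h (x * y) = h x * h y.

(* Main.v *)
Require Import Defs.
From mathcomp Require Import all_boot all_order all_algebra.
From mathcomp Require Import boolp classical_sets functions reals topology.

(** An orbit equivalence F carries full groups to full groups by conjugation,
hence their commutator subgroups, which is one implication.  For the converse,
the isomorphism has to be shown to be conjugation by a homeomorphism; since
the orbits of D([phi]) are those of phi, that homeomorphism is then an orbit
equivalence.  This is an instance of Rubin's theorem: enough of the action can
be read off from the group.

What makes it work is that D([phi]) is locally minimal: inside any open set V,
the elements supported in V move a given point of V into any given nonempty
open subset of V.  Indeed if x, y and z are three points of one orbit in V,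
zero-dimensionality gives an involution s of the full group supported in V,
avoiding z and exchanging x and y, and likewise t exchanging x and z; the
commutator of s and t is supported in V and sends x to y
([commutator_locally_transitive]).  A third point z exists because orbits are
dense and there are no isolated points.

For a locally minimal group, the relation supp f `<=` closure (supp g) has a
description that mentions the group law only ([dominatedP]).  It rests on a
condition, [alg_disjoint], that holds when f and g have disjoint supports and
that forces the supports of f and of g ^+ 12 to be disjoint.

Points are then recovered as follows.  Given an isomorphism a, a point x
corresponds to a point y when y lies in closure (supp (a f)) for every f that
moves x.  Compactness provides such a y.  Local minimality shows that x in the
interior of closure (supp f) implies y in the interior of
closure (supp (a f)) ([corresponds_hull]).  Applying this to a and to its
inverse shows that the correspondence is one-to-one, and continuous because
the interiors in question form a base of the topology.  It
visibly commutes with the two actions ([rubin_reconstruction]). *)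

Set Implicit Arguments.
Unset Strict Implicit.
Unset Printing Implicit Defensive.

Local Open Scope classical_set_scope.
Local Open Scope group_scope.

(** * Abstract subgroups and the algebraic shadow of disjoint supports *)

Section subgroup_theory.
Context {G : groupType} {H : set G} (sH : subgroup H).

Lemma subgroup1 : H 1. Proof. by case: sH. Qed.

Lemma subgroupM x y : H x -> H y -> H (x * y).
Proof. by case: sH => _ HM _; exact: HM. Qed.

Lemma subgroupV x : H x -> H x^-1.
Proof. by case: sH => _ _; exact. Qed.

Lemma subgroupX x n : H x -> H (x ^+ n).
Proof.
move=> Hx; elim: n => [|n IHn]; first exact: subgroup1.
by rewrite expgS; exact: subgroupM.
Qed.

Lemma subgroupR x y : H x -> H y -> H [~ x, y].
Proof.
by move=> Hx Hy; rewrite /commg /conjg; do !apply: subgroupM => //;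
  exact: subgroupV.
Qed.

End subgroup_theory.

(** Disjointness of supports, as seen by the group.  If the supports of f and g
are disjoint and h does not commute with f, then f1 and f2 can be taken in a
small piece of the support of f, so that they commute with g. Conversely, the
element [~ f1, [~ f2, h]] is supported in at most four translates of the
support of h; it cannot commute with g if g spreads that support over five
disjoint sets. *)
Definition alg_disjoint (G : groupType) (H : set G) (f g : G) : Prop :=
  forall h, H h -> ~ commute f h ->
  exists f1 f2, [/\ H f1, H f2, commute f1 g & commute f2 g] /\
    [~ f1, [~ f2, h]] <> 1 /\ commute [~ f1, [~ f2, h]] g.

(** The algebraic form of supp f `<=` closure (supp g): what avoids g avoids f.
The power 12 is the one that [alg_disjoint] controls. *)
Definition dominated (G : groupType) (H : set G) (f g : G) : Prop :=
  forall h, H h -> alg_disjoint H g h -> commute (h ^+ 12) f.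

(** Both directions are kept, as functions on the ambient groups, so that every
statement about an isomorphism can be applied to its inverse. *)
Record subgroup_iso (G1 G2 : groupType) (H1 : set G1) (H2 : set G2)
    (a : G1 -> G2) (b : G2 -> G1) : Prop := SubgroupIso {
  iso_source : subgroup H1;
  iso_target : subgroup H2;
  iso_fun : forall x, H1 x -> H2 (a x);
  iso_inv : forall y, H2 y -> H1 (b y);
  iso_funK : forall x, H1 x -> b (a x) = x;
  iso_invK : forall y, H2 y -> a (b y) = y;
  isoM : forall x y, H1 x -> H1 y -> a (x * y) = a x * a y }.

Section subgroup_iso_theory.
Context {G1 G2 : groupType} {H1 : set G1} {H2 : set G2}.
Context {a : G1 -> G2} {b : G2 -> G1} (ab : subgroup_iso H1 H2 a b).
Let sH1 := iso_source ab.

Lemma iso_inj x y : H1 x -> H1 y -> a x = a y -> x = y.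
Proof.
by move=> Hx Hy /(congr1 b); rewrite !(iso_funK ab).
Qed.

Lemma iso1 : a 1 = 1.
Proof.
apply: (@mulgI _ (a 1)); rewrite -(isoM ab) ?mulg1 //; exact: subgroup1 sH1.
Qed.

Lemma isoV x : H1 x -> a x^-1 = (a x)^-1.
Proof.
move=> Hx; apply: (@mulgI _ (a x)); rewrite -(isoM ab) //; last first.
  exact: subgroupV.
by rewrite !mulgV iso1.
Qed.

Lemma isoX x n : H1 x -> a (x ^+ n) = a x ^+ n.
Proof.
move=> Hx; elim: n => [|n IHn]; first exact: iso1.
by rewrite !expgS (isoM ab) ?IHn //; exact: subgroupX.
Qed.

Lemma isoR x y : H1 x -> H1 y -> a [~ x, y] = [~ a x, a y].
Proof.
move=> Hx Hy; have [Vx Vy] := (subgroupV sH1 Hx, subgroupV sH1 Hy).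
rewrite /commg /conjg !(isoM ab) ?isoV //; do ?apply: (subgroupM sH1) => //.
Qed.

Lemma iso_commute x y : H1 x -> H1 y -> commute (a x) (a y) <-> commute x y.
Proof.
move=> Hx Hy; rewrite /commute -!(isoM ab) //; split => [|-> //].
by apply: iso_inj; exact: subgroupM.
Qed.

Lemma subgroup_iso_sym : subgroup_iso H2 H1 b a.
Proof.
case: ab => s1 s2 aH bH aK bK aM; split=> // x y Hx Hy.
rewrite -{1}(bK _ Hx) -{1}(bK _ Hy) -aM ?aK //; try exact: bH.
by apply: subgroupM => //; exact: bH.
Qed.

End subgroup_iso_theory.

Section transfer.
Context {G1 G2 : groupType} {H1 : set G1} {H2 : set G2}.
Context {a : G1 -> G2} {b : G2 -> G1} (ab : subgroup_iso H1 H2 a b).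

Lemma alg_disjoint_iso f g : H1 f -> H1 g ->
  alg_disjoint H1 f g -> alg_disjoint H2 (a f) (a g).
Proof.
move=> Hf Hg fg h2 Hh2 ncfh.
have Hh := iso_inv ab Hh2; rewrite -(iso_invK ab Hh2) in ncfh *.
have [|f1 [f2 [[Hf1 Hf2 c1 c2] [k1 kg]]]] := fg _ Hh.
  by move=> /(iso_commute ab Hf Hh).
have Hk2 := subgroupR (iso_source ab) Hf2 Hh.
have Hk := subgroupR (iso_source ab) Hf1 Hk2.
exists (a f1), (a f2); split; first split; try exact: (iso_fun ab).
- exact/(iso_commute ab).
- exact/(iso_commute ab).
rewrite -(isoR ab Hf2 Hh) -(isoR ab Hf1 Hk2); split; last first.
  exact/(iso_commute ab).
rewrite -(iso1 ab) => /(iso_inj ab) k1'; apply: k1; apply: k1' => //.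
exact: subgroup1 (iso_source ab).
Qed.

End transfer.

Lemma dominated_iso (G1 G2 : groupType) (H1 : set G1) (H2 : set G2)
    (a : G1 -> G2) (b : G2 -> G1) (ab : subgroup_iso H1 H2 a b) f g :
  H1 f -> H1 g -> dominated H1 f g -> dominated H2 (a f) (a g).
Proof.
move=> Hf Hg fg h2 Hh2 gh2; have Hh := iso_inv ab Hh2.
rewrite -(iso_invK ab Hh2) -(isoX ab) //; apply/(iso_commute ab) => //.
  exact: (subgroupX (iso_source ab)).
apply: fg => //; rewrite -(iso_funK ab Hg).
by apply: (alg_disjoint_iso (subgroup_iso_sym ab)) => //; exact: (iso_fun ab).
Qed.

(** * Supports of homeomorphisms *)

Section homeo_theory.
Context {X : topologicalType}.
Implicit Types (f g h : homeo X X) (V : set X).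

Lemma homeo_mulKV f x : f^-1 (f x) = x.
Proof. exact: homeoK. Qed.

Lemma homeo_mulVK f x : f (f^-1 x) = x.
Proof. exact: homeo_invK. Qed.

Lemma homeo_inj f : injective f.
Proof. exact: can_inj (homeoK f). Qed.

Lemma homeo_expS g n x : (g ^+ n.+1) x = g ((g ^+ n) x).
Proof. by rewrite expgS. Qed.

Lemma homeo_expD g m n x : (g ^+ (m + n)) x = (g ^+ m) ((g ^+ n) x).
Proof. by rewrite expgnDr. Qed.

Lemma homeo_preimage_open f V : open V -> open (f @^-1` V).
Proof. by move=> oV; apply: open_comp => // x _; exact: homeo_continuous. Qed.

Definition moved f : set X := [set x | f x != x].

Lemma unmoved f V x : moved f `<=` V -> ~ V x -> f x = x.
Proof. by move=> fV Vx; apply/eqP; apply/negPn/negP => /fV. Qed.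

Lemma moved_stable f x : moved f x -> moved f (f x).
Proof. by rewrite /moved/= (inj_eq (@homeo_inj f)). Qed.

Lemma movedV f : moved f^-1 = moved f.
Proof.
apply/seteqP; split=> x; apply: contra_neq => fx.
  by rewrite -[in LHS]fx homeo_mulKV.
by rewrite -[in LHS]fx homeo_mulVK.
Qed.

Lemma moved1 V : moved 1 `<=` V.
Proof. by move=> x /eqP. Qed.

Lemma movedM f g V : moved f `<=` V -> moved g `<=` V -> moved (f * g) `<=` V.
Proof.
move=> fV gV x; apply: contraPP => Vx; apply/negP; rewrite negbK; apply/eqP.
by rewrite -[RHS](unmoved fV Vx) -{2}(unmoved gV Vx).
Qed.

Lemma movedX f n V : moved f `<=` V -> moved (f ^+ n) `<=` V.
Proof.
move=> fV; elim: n => [|n IHn]; first exact: moved1.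
by rewrite expgS; exact: movedM.
Qed.

Lemma moved_commute f g : (forall x, moved f x -> g x = x) -> commute f g.
Proof.
move=> fg; apply: homeoP => x /=; rewrite -[LHS]/(f (g x)) -[RHS]/(g (f x)).
have [fx|mfx] := eqVneq (f x) x; last first.
  by rewrite (fg _ mfx) (fg _ (moved_stable mfx)).
rewrite fx; have [gx|mgx] := eqVneq (g x) x; first by rewrite gx fx.
have [//|/fg/homeo_inj] := eqVneq (f (g x)) (g x).
by move/eqP: mgx.
Qed.

Hypothesis hausX : hausdorff_space X.

Lemma moved_separation g x : moved g x ->
  exists V, [/\ open V, V x & forall z, V z -> ~ V (g z)].
Proof.
move=> gx; move: hausX; rewrite open_hausdorff => /(_ x (g x)).
rewrite eq_sym => /(_ gx) [[A B] /= [/set_mem Ax /set_mem Bgx] [oA oB /eqP AB]].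
exists (A `&` g @^-1` B); split=> //.
  by apply: openI => //; exact: homeo_preimage_open.
move=> z [_ Bgz] [Agz _]; have : (A `&` B) (g z) by [].
by rewrite AB.
Qed.

Lemma moved_open g : open (moved g).
Proof.
rewrite openE => x /moved_separation [V [oV Vx Vg]].
apply: (@filterS _ _ _ V); last exact: open_nbhs_nbhs.
by move=> z Vz; apply/eqP => gz; apply: (Vg z Vz); rewrite gz.
Qed.

(** In a Hausdorff space, finitely many iterates that move x also move a whole
neighbourhood of x off itself. *)
Lemma iterates_separation g x n :
    (forall j, 0 < j <= n -> moved (g ^+ j) x) ->
  exists V, [/\ open V, V x &
    forall j, 0 < j <= n -> forall z, V z -> ~ V ((g ^+ j) z)].
Proof.
elim: n => [|n IHn] mg.
  exists setT; split=> // [|j]; first exact: openT.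
  by case: j.
have [j /andP[j0 jn]|V [oV Vx Vg]] := IHn.
  by apply: mg; rewrite j0 leqW.
have [|W [oW Wx Wg]] := @moved_separation (g ^+ n.+1) x.
  by apply: mg; rewrite leqnn.
exists (V `&` W); split=> //; first exact: openI.
move=> j /andP[j0]; rewrite leq_eqVlt => /predU1P[->|jn] z [Vz Wz] [Vgz Wgz].
  exact: Wg Wgz.
by apply: Vg Vgz => //; rewrite j0.
Qed.

End homeo_theory.

(** * Locally minimal groups *)

(** A strong form of the local density hypothesis of Rubin's theorem: the
elements supported in V act minimally on V. *)
Definition locally_minimal (X : topologicalType) (H : set (homeo X X)) : Prop :=
  forall (V W : set X) (x : X), open V -> V x -> open W -> W !=set0 ->
  W `<=` V -> exists g, [/\ H g, moved g `<=` V & W (g x)].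

Section locally_minimal_theory.
Context {X : topologicalType} {H : set (homeo X X)}.
Hypothesis hausX : hausdorff_space X.
Hypothesis perfectX : isolated [set: X] = set0.
Hypothesis sH : subgroup H.
Hypothesis minH : locally_minimal H.
Implicit Types (f g h : homeo X X) (V : set X).

Lemma open_setD1 V x : open V -> open (V `\ x).
Proof.
move=> oV; rewrite setDE; apply: openI => //; apply: closed_openC.
exact: (accessible_closed_set1 (hausdorff_accessible hausX)).
Qed.

Lemma perfect_open V x : open V -> V !=set0 -> V `\ x !=set0.
Proof.
move=> oV [y Vy]; apply: contrapT => V0.
suff : isolated [set: X] x by rewrite perfectX.
have VE z : V z -> z = x.
  by move=> Vz; apply: contrapT => zx; apply: V0; exists z.
split; first exact: in_setT.
exists V; first by rewrite -(VE y Vy); exact: open_nbhs_nbhs.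
rewrite setIT; apply/seteqP; split=> z; first exact: VE.
by move=> ->; rewrite -(VE y Vy).
Qed.

Lemma exists_moving V x : open V -> V x ->
  exists g, [/\ H g, moved g `<=` V & moved g x].
Proof.
move=> oV Vx; have [] := minH oV Vx (open_setD1 x oV).
- by apply: perfect_open => //; exists x.
- exact: subDsetl.
by move=> g [Hg gV [_ /eqP gx]]; exists g.
Qed.

(** If f moves x, then f does not commute with an element that moves x and is
supported in a set which f moves off itself. *)
Lemma noncommuting_pair V : open V -> V !=set0 -> exists f g,
  [/\ H f, H g, moved f `<=` V, moved g `<=` V & ~ commute f g].
Proof.
move=> oV [x Vx]; have [f [Hf fV fx]] := exists_moving oV Vx.
have [A [oA Ax Af]] := moved_separation hausX fx.
have [|g [Hg gVA gx]] := @exists_moving (V `&` A) x (openI oV oA); first by [].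
exists f, g; split=> //; first by move=> z /gVA [].
move=> /(congr1 (fun u : homeo X X => u x)) /=.
rewrite -[LHS]/(f (g x)) -[RHS]/(g (f x)).
rewrite [RHS](unmoved gVA) => [/homeo_inj gxx|[_]]; last exact: Af.
by rewrite /moved /= gxx eqxx in gx.
Qed.

(** No bounded exponent on any open set.  If x is fixed by g ^+ k.+1 but by no
smaller power, let h move x within a set A disjoint from its first k
translates: the orbit of x under g * h follows that of h x under g, and it
does not close up after k.+1 steps because h x != x. *)
Lemma long_orbit k V : open V -> V !=set0 -> exists g x,
  [/\ H g, moved g `<=` V, V x & forall j, 0 < j <= k -> moved (g ^+ j) x].
Proof.
move=> oV [x0 Vx0]; elim: k => [|k [g [x [Hg gV Vx gx]]]].
  exists 1, x0; split=> //; [exact: subgroup1|exact: moved1|by case].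
have [gkx|mgkx] := eqVneq ((g ^+ k.+1) x) x; last first.
  exists g, x; split=> // j /andP[j0].
  by rewrite leq_eqVlt => /predU1P[->//|jk]; apply: gx; rewrite j0.
have [A [oA Ax Ag]] := iterates_separation hausX gx.
have [|h [Hh hVA hx]] := @exists_moving (V `&` A) x (openI oV oA); first by [].
have [Vhx Ahx] := hVA _ (moved_stable hx).
have uE j : j <= k -> ((g * h) ^+ j.+1) x = (g ^+ j.+1) (h x).
  elim: j => [//|j IHj] jk; rewrite homeo_expS IHj 1?ltnW //.
  rewrite [RHS]homeo_expS -[LHS]/(g (h _)); congr (homeo_fun g _).
  by apply: (unmoved hVA) => -[_]; apply: Ag => //; rewrite ltnW.
exists (g * h), x; split=> //.
- exact: subgroupM.
- by apply: movedM => // z /hVA [].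
move=> [//|j] /= jk; rewrite /moved /= uE //; apply/eqP => uj.
have [jk'|] := ltnP j k; first by apply: (Ag j.+1 jk' _ Ahx); rewrite uj.
move=> kj; have {jk kj}jk : j = k by apply/eqP; rewrite eqn_leq -ltnS jk.
move: uj; rewrite jk -{2}gkx => /homeo_inj hxx.
by rewrite /moved /= hxx eqxx in hx.
Qed.

(** Let V be a piece of supp f with V and h V disjoint. For f1 and f2 supported
in V, f2 ^ h is supported away from V, so that it drops out of the iterated
commutator, which is therefore [~ f1, f2^-1]. *)
Lemma moved_disjoint_alg_disjoint f g :
  (forall x, moved f x -> g x = x) -> alg_disjoint H f g.
Proof.
move=> fg h Hh ncfh.
have [x [fx hx]] : exists x, moved f x /\ moved h^-1 x.
  apply: contrapT => nx; apply/ncfh/moved_commute => x fx.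
  apply/eqP; apply/negPn/negP => hx; apply: nx; exists x; split => //.
  by rewrite movedV.
have [A [oA Ax Ah]] := moved_separation hausX hx.
pose V := moved f `&` A; have oV : open V by apply: openI oA; exact: moved_open.
have [|f1 [f2 [Hf1 Hf2 f1V f2V nc12]]] := noncommuting_pair oV.
  by exists x.
have cg u : moved u `<=` V -> commute u g.
  by move=> uV; apply: moved_commute => z /uV [/fg].
have mh u : moved u `<=` V -> commute u (f2 ^ h).
  move=> uV; apply: moved_commute => z /uV [_ Az].
  rewrite -[LHS]/(h^-1 (f2 (h z))) (unmoved f2V) ?homeo_mulKV // => -[_].
  by move/Ah; rewrite homeo_mulKV.
(* [~ f2, h] = f2^-1 * f2 ^ h, and f2 ^ h commutes with f1 and f2. *)
have kE : [~ f1, [~ f2, h]] = [~ f1, f2^-1].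
  have cm : commute (f2 ^ h) (f1 ^ f2^-1).
    have [cm1 cm2] := (commute_sym (mh _ f1V), commute_sym (mh _ f2V)).
    rewrite /(f1 ^ _) invgK.
    by do !apply: commuteM => //; exact: commuteV.
  rewrite !commgEl conjgM; congr (_ * _).
  by rewrite [LHS]conjgE -cm mulKg.
exists f1, f2; split; first by split=> //; exact: cg.
rewrite kE; split.
  move=> c1; apply/nc12; have := commgC f1 f2^-1; rewrite c1 mulg1.
  by move/commuteV; rewrite invgK.
have [cg1 cg2] := (commute_sym (cg _ f1V), commute_sym (cg _ f2V)).
apply/commute_sym; rewrite /commg /conjg invgK.
by do !apply: commuteM => //; exact: commuteV.
Qed.

(** If g ^+ 12 moves a point x of supp f, no power g ^+ j with 0 < j <= 4 fixes
x, all these j being divisors of 12.  Take h supported in a set A that is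
disjoint from its first four translates by g.  Any point moved by
k = [~ f1, [~ f2, h]] is sent to A by one of 1, f1, f2, f2 * f1.  As k commutes
with g, it moves the five points w, ..., (g ^+ 4) w with some w, and two of them
are sent to A by the same element, which commutes with g: a power of g then
maps a point of A into A, which is excluded. *)
Lemma alg_disjoint_moved f g : alg_disjoint H f g ->
  forall x, moved f x -> (g ^+ 12) x = x.
Proof.
move=> fg x fx; apply/eqP; apply/negPn/negP => g12x.
have gx j : 0 < j <= 4 -> moved (g ^+ j) x.
  move=> j4; apply: contra_neq g12x => gj.
  have gjn n : (g ^+ (n * j)) x = x.
    by elim: n => // n IHn; rewrite mulSn homeo_expD IHn.
  have [n <-] : exists n, (n * j)%N = 12; last exact: gjn.
  by move: j j4 {gj gjn} => [|[|[|[|[|]]]]] // _;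
    [exists 12|exists 6|exists 4|exists 3].
have [A [oA Ax Ag]] := iterates_separation hausX gx.
have [B [oB Bx Bf]] := moved_separation hausX fx.
have [|h [Hh hAB hx]] := @exists_moving (A `&` B) x (openI oA oB); first by [].
have [|f1 [f2 [[Hf1 Hf2 c1 c2] [k1 kg]]]] := fg h Hh.
  move=> /(congr1 (fun u : homeo X X => u x)) /=.
  rewrite -[LHS]/(f (h x)) -[RHS]/(h (f x)).
  rewrite [RHS](unmoved hAB) => [/homeo_inj hxx|[_]]; last exact: Bf.
  by rewrite /moved /= hxx eqxx in hx.
set k := [~ f1, [~ f2, h]] in k1 kg.
have [w kw] : exists w, moved k w.
  apply: contrapT => nw; apply: k1; apply: homeoP => w.
  by apply/eqP; apply/negPn/negP => kw; apply: nw; exists w.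
have hV z : moved h z -> A z by move=> /hAB [].
have fix2 z : ~ A z -> ~ A (f2 z) -> [~ f2, h] z = z.
  move=> Az Af2z; rewrite -[LHS]/(f2^-1 (h^-1 (f2 (h z)))).
  rewrite (unmoved hV Az) (@unmoved _ h^-1 A) ?homeo_mulKV //.
  by rewrite movedV.
pose u (e : bool * bool) : homeo X X := f2 ^+ e.2 * f1 ^+ e.1.
have cu e : commute (u e) g.
  by apply/commute_sym/commuteM; apply: commuteX.
have cover z : moved k z -> exists e, A (u e z).
  apply: contraPP => nz; apply/negP; rewrite negbK; apply/eqP.
  have nA e : ~ A (u e z) by move=> Ae; apply: nz; exists e.
  have z1 : [~ f2, h] z = z.
    by apply: fix2; [exact: (nA (false, false))|exact: (nA (false, true))].
  have z2 : [~ f2, h] (f1 z) = f1 z.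
    by apply: fix2; [exact: (nA (true, false))|exact: (nA (true, true))].
  rewrite -[LHS]/(f1^-1 ([~ f2, h]^-1 (f1 ([~ f2, h] z)))).
  by rewrite z1 -{1}z2 !homeo_mulKV.
have kgj j : moved k ((g ^+ j) w).
  elim: j => [//|j IHj]; rewrite homeo_expS /moved /=.
  rewrite -[X in X != _]/((k * g) ((g ^+ j) w)) kg -[X in X != _]/(g (k _)).
  by rewrite (inj_eq (@homeo_inj _ g)).
have [c Ac] := choice (fun j : 'I_5 => cover _ (kgj j)).
have ninj : ~ injective c.
  by move=> /leq_card; rewrite card_ord card_prod card_bool.
apply: ninj => i j cij.
wlog ij : i j cij / (i <= j)%N => [wl|].
  by have [/wl ->|/ltnW/wl ->] := leqP i j.
apply/val_inj/eqP; rewrite eqn_leq ij leqNgt /=; apply/negP => lij.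
have Aj := Ac j; rewrite -cij in Aj.
have guE n z : u (c i) ((g ^+ n) z) = (g ^+ n) (u (c i) z).
  rewrite -[LHS]/((u (c i) * g ^+ n) z) -[RHS]/((g ^+ n * u (c i)) z).
  by congr (homeo_fun _ z); apply: commuteX.
move: Aj; rewrite -(subnK ij) homeo_expD guE; apply: Ag (Ac i).
rewrite subn_gt0 lij /=; apply: leq_trans (leq_subr _ _) _.
by rewrite -ltnS.
Qed.

(** If f moves a point outside closure (supp g), it does not commute with the
twelfth power of some h supported near that point, although h is disjoint
from g. *)
Lemma dominatedP f g :
  dominated H f g <-> moved f `<=` closure (moved g).
Proof.
split=> [fg x fx B Bx|fg h Hh gh]; last first.
  apply: moved_commute => x hx; apply/eqP; apply/negPn/negP => /fg /(_ _ _).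
  case/(_ (moved (h ^+ 12))) => [|z [gz /eqP]].
    by apply: open_nbhs_nbhs; split=> //; exact: moved_open.
  by rewrite (alg_disjoint_moved gh gz).
apply: contrapT => gB.
have [A [oA Ax Af]] := moved_separation hausX fx.
move: Bx; rewrite nbhsE => -[C [oC Cx CB]].
have [|h [z [Hh hAC [Az Cz] hz]]] := long_orbit 12 (openI oA oC).
  by exists x.
have h12 : moved (h ^+ 12) `<=` A by move=> y /(movedX hAC) [].
have /(congr1 (fun u : homeo X X => u z)) : commute (h ^+ 12) f.
  apply: fg => //; apply: moved_disjoint_alg_disjoint => y gy.
  apply: (unmoved hAC) => -[_ Cy]; apply: gB; exists y; split=> //.
  exact: CB.
rewrite -[LHS]/((h ^+ 12) (f z)) -[RHS]/(f ((h ^+ 12) z)).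
rewrite (unmoved h12 (Af z Az)) => /homeo_inj zE.
by have /eqP := hz 12 isT; apply; exact/esym.
Qed.

End locally_minimal_theory.

(** * Reconstruction of the space *)

Record rubin_action (X : topologicalType) (H : set (homeo X X)) : Prop :=
  RubinAction {
  rubin_hausdorff : hausdorff_space X;
  rubin_compact : compact [set: X];
  rubin_perfect : isolated [set: X] = set0;
  rubin_minimal : locally_minimal H }.

(** The regular open set generated by the support: a group isomorphism preserves
the inclusions between these sets, but not those between supports. *)
Definition hull (X : topologicalType) (f : homeo X X) : set X :=
  (closure (moved f))°.

Section hull_theory.
Context {X : topologicalType}.
Implicit Types (f g : homeo X X).

Lemma hull_closure f : hull f `<=` closure (moved f).
Proof. exact: interior_subset. Qed.

Lemma open_hull f : open (hull f).
Proof. exact: open_interior. Qed.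

Lemma moved_hull f g : hausdorff_space X ->
  moved f `<=` closure (moved g) -> moved f `<=` hull g.
Proof.
move=> hX fg x fx; apply: (filterS fg).
by apply: open_nbhs_nbhs; split=> //; exact: moved_open.
Qed.

Lemma moved_conjg f g x : moved (f ^ g) x <-> moved f (g x).
Proof.
rewrite -[moved (f ^ g) x]/(is_true (g^-1 (f (g x)) != x)).
split; apply: contra_neq => fx; first by rewrite fx homeo_mulKV.
by rewrite -[in RHS]fx homeo_mulVK.
Qed.

Lemma closure_conjg f g x :
  closure (moved (f ^ g)) x -> closure (moved f) (g x).
Proof.
move=> fgx B /(homeo_continuous g) /fgx [z [/moved_conjg fz Bz]].
by exists (g z).
Qed.

Lemma regular_nbhs (x : X) (O : set X) :
    hausdorff_space X -> compact [set: X] -> open O -> O x ->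
  exists N, [/\ open N, N x & closure N `<=` O].
Proof.
move=> hX cX oO Ox.
have nO : nbhs x O by exact: open_nbhs_nbhs.
have [N] := @compact_regular _ x _ hX cX filterT O nO.
rewrite /= nbhsE => -[M [oM Mx MN]] NO; exists M; split=> //.
exact: subset_trans (closureS MN) NO.
Qed.

End hull_theory.

(** The supports that contain x shrink to x; y is a point towards which their
images shrink. *)
Definition corresponds (X1 X2 : topologicalType) (H1 : set (homeo X1 X1))
    (a : homeo X1 X1 -> homeo X2 X2) (x : X1) (y : X2) : Prop :=
  forall f, H1 f -> moved f x -> closure (moved (a f)) y.

Section support_transfer.
Context {X1 X2 : topologicalType}.
Context {H1 : set (homeo X1 X1)} {H2 : set (homeo X2 X2)}.
Context {a : homeo X1 X1 -> homeo X2 X2} {b : homeo X2 X2 -> homeo X1 X1}.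
Hypothesis ab : subgroup_iso H1 H2 a b.
Hypotheses (r1 : rubin_action H1) (r2 : rubin_action H2).
Let h1 := rubin_hausdorff r1.
Let h2 := rubin_hausdorff r2.
Let s1 := iso_source ab.
Let s2 := iso_target ab.
Let moving1 := exists_moving h1 (rubin_perfect r1) (rubin_minimal r1).

Lemma moved_iso f g : H1 f -> H1 g ->
  moved f `<=` closure (moved g) -> moved (a f) `<=` closure (moved (a g)).
Proof.
move=> Hf Hg fg; have [p1 p2] := (rubin_perfect r1, rubin_perfect r2).
have [m1 m2] := (rubin_minimal r1, rubin_minimal r2).
apply/(dominatedP h2 p2 s2 m2); apply: (dominated_iso ab) => //.
exact/(dominatedP h1 p1 s1 m1).
Qed.

Lemma moved_iso_neq0 f : H1 f -> moved f !=set0 -> moved (a f) !=set0.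
Proof.
move=> Hf [x fx]; apply: contrapT => af0.
suff f1 : f = 1 by rewrite f1 /moved /= eqxx in fx.
apply: (iso_inj ab) => //; first exact: subgroup1 s1.
rewrite (iso1 ab); apply: homeoP => y; apply/eqP; apply/negPn/negP => afy.
by apply: af0; exists y.
Qed.

(** The sets closure (supp (a f)), for f moving x, form a filter base, since the
intersection of two supports contains a third one around x. *)
Lemma corresponds_exists x : exists y, corresponds H1 a x y.
Proof.
pose F := filter_from [set f | H1 f /\ moved f x]
  (fun f => closure (moved (a f))).
have FF : ProperFilter F.
  apply: filter_from_proper; last first.
    move=> f [Hf fx]; have [|y afy] := moved_iso_neq0 Hf; first by exists x.
    by exists y; exact: subset_closure.
  apply: filter_from_filter.
    by have [f [Hf _ fx]] := moving1 openT (I : setT x); exists f.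
  move=> f g [Hf fx] [Hg gx].
  have ofg : open (moved f `&` moved g) by apply: openI; exact: moved_open.
  have [//|k [Hk kfg kx]] := moving1 ofg (x := x).
  have kU u : H1 u -> moved k `<=` moved u ->
      closure (moved (a k)) `<=` closure (moved (a u)).
    move=> Hu ku; have /closure_id -> := @closed_closure _ (moved (a u)).
    apply: closureS; apply: moved_iso => //.
    exact: subset_trans ku (@subset_closure _ _).
  exists k => // y ky.
  by split; apply: kU ky => // z /kfg [].
have [y [_ Fy]] := rubin_compact r2 FF filterT.
exists y => f Hf fx; have /closure_id -> := @closed_closure _ (moved (a f)).
by move=> B; apply: Fy; exists f.
Qed.

End support_transfer.

Section correspondence.
Context {X1 X2 : topologicalType}.
Context {H1 : set (homeo X1 X1)} {H2 : set (homeo X2 X2)}.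
Context {a : homeo X1 X1 -> homeo X2 X2} {b : homeo X2 X2 -> homeo X1 X1}.
Hypothesis ab : subgroup_iso H1 H2 a b.
Hypotheses (r1 : rubin_action H1) (r2 : rubin_action H2).
Let ba := subgroup_iso_sym ab.
Let h1 := rubin_hausdorff r1.
Let h2 := rubin_hausdorff r2.
Let s1 := iso_source ab.
Let Ha := iso_fun ab.
Let Hb := iso_inv ab.
Let bK := iso_invK ab.

Lemma isoJ f g : H1 f -> H1 g -> a (f ^ g) = a f ^ a g.
Proof.
move=> Hf Hg; have Vg := subgroupV s1 Hg.
by rewrite /conjg !(isoM ab) ?(isoV ab) //; exact: subgroupM.
Qed.

(** If y is not in hull (a f), every element supported there fixes y. Choose c
with closure (supp c) inside supp (a k) for some k dominated by f, and g
supported in hull f sending x into supp (b c). The conjugate of b c by g moves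
x, so y is in the closure of the support of c ^ (a g); since a g fixes y, y is
in closure (supp c), hence in hull (a f). *)
Lemma corresponds_hull x y f :
  corresponds H1 a x y -> H1 f -> hull f x -> hull (a f) y.
Proof.
move=> xy Hf fx; apply: contrapT => nfy.
have [k [Hk kf kx]] := exists_moving h1 (rubin_perfect r1) (rubin_minimal r1)
  (@open_hull _ f) fx.
have {}kf := subset_trans kf (@hull_closure _ f).
have akf : moved (a k) `<=` hull (a f).
  by apply: moved_hull => //; apply: (moved_iso ab r1 r2).
have [|z akz] := moved_iso_neq0 ab Hk; first by exists x.
have [N [oN Nz Nk]] :=
  regular_nbhs h2 (rubin_compact r2) (moved_open h2 (a k)) akz.
have [c [Hc cN cz]] :=
  exists_moving h2 (rubin_perfect r2) (rubin_minimal r2) oN Nz.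
have cf : moved c `<=` closure (moved (a f)).
  by move=> w /cN /(@subset_closure _ N) /Nk /akf /hull_closure.
have bcf : moved (b c) `<=` hull f.
  apply: moved_hull => //; rewrite -[f](iso_funK ab Hf).
  by apply: (moved_iso ba r2 r1) => //; exact: Ha.
have [|g [Hg gf gx]] := rubin_minimal r1 (@open_hull _ f) fx
    (moved_open h1 (b c)) _ bcf.
  by apply: (moved_iso_neq0 ba) => //; exists z.
have gy : a g y = y.
  apply: (unmoved _ nfy); apply: moved_hull => //.
  apply: (moved_iso ab r1 r2) => //.
  exact: subset_trans gf (@hull_closure _ f).
have Hcg : H1 (b c ^ g).
  have Vg := subgroupV s1 Hg.
  by rewrite /conjg; do !apply: (subgroupM s1) => //; exact: Hb.
have := xy _ Hcg; rewrite isoJ //; last exact: Hb.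
rewrite bK // => /(_ _)/closure_conjg; rewrite gy => cy; apply/nfy/akf/Nk.
by apply: (closureS cN); apply: cy; apply/moved_conjg.
Qed.

Lemma corresponds_equivariant x y g :
  corresponds H1 a x y -> H1 g -> corresponds H1 a (g x) (a g y).
Proof.
move=> xy Hg f Hf fgx; apply: closure_conjg; rewrite -isoJ //.
apply: xy; last exact/moved_conjg.
by rewrite /conjg; do !apply: (subgroupM s1) => //; exact: subgroupV.
Qed.

End correspondence.

Section reconstruction.
Context {X1 X2 : topologicalType}.
Context {H1 : set (homeo X1 X1)} {H2 : set (homeo X2 X2)}.
Context {a : homeo X1 X1 -> homeo X2 X2} {b : homeo X2 X2 -> homeo X1 X1}.
Hypothesis ab : subgroup_iso H1 H2 a b.
Hypotheses (r1 : rubin_action H1) (r2 : rubin_action H2).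
Let ba := subgroup_iso_sym ab.
Let h1 := rubin_hausdorff r1.
Let h2 := rubin_hausdorff r2.

(** By [corresponds_hull] twice, x' lies in every hull f that contains x. *)
Lemma corresponds_cancel x y x' :
  corresponds H1 a x y -> corresponds H2 b y x' -> x = x'.
Proof.
move=> xy yx'; have [//|xx'] := eqVneq x x'; exfalso.
move: (h1); rewrite open_hausdorff => /(_ _ _ xx') [[A B] /=].
move=> [/set_mem Ax /set_mem Bx'] [oA oB /eqP AB].
have [f [Hf fA fx]] :=
  exists_moving h1 (rubin_perfect r1) (rubin_minimal r1) oA Ax.
have fhull : hull f x by apply: moved_hull fx => //; exact: subset_closure.
have /(corresponds_hull ba r2 r1 yx') := corresponds_hull ab r1 r2 xy Hf fhull.
rewrite (iso_funK ab Hf) => /(_ (iso_fun ab Hf)) /hull_closure /(closureS fA).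
move=> /(_ B) [|z ABz]; first exact: open_nbhs_nbhs.
by rewrite AB in ABz.
Qed.

Lemma corresponds_sym x y : corresponds H1 a x y -> corresponds H2 b y x.
Proof.
move=> xy; have [x' yx'] := corresponds_exists ba r2 r1 y.
by rewrite (corresponds_cancel xy yx').
Qed.

Lemma corresponds_continuous (F : X1 -> X2) :
  (forall x, corresponds H1 a x (F x)) -> continuous F.
Proof.
move=> xF x B; rewrite nbhsE => -[C [oC CFx] CB].
have [N [oN NFx NC]] := regular_nbhs h2 (rubin_compact r2) oC CFx.
have [g [Hg gN gFx]] :=
  exists_moving h2 (rubin_perfect r2) (rubin_minimal r2) oN NFx.
have bgx : hull (b g) x.
  apply: (corresponds_hull ba r2 r1 (corresponds_sym (xF x)) Hg).
  by apply: moved_hull gFx => //; exact: subset_closure.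
apply: (@filterS _ _ _ (hull (b g))); last first.
  by apply: open_nbhs_nbhs; split=> //; exact: open_hull.
move=> z /(corresponds_hull ab r1 r2 (xF z) (iso_inv ab Hg)).
by rewrite (iso_invK ab Hg) => /hull_closure /(closureS gN) /NC /CB.
Qed.

End reconstruction.

(** Rubin's theorem for locally minimal groups of homeomorphisms of compact
Hausdorff spaces without isolated points. *)
Theorem rubin_reconstruction (X1 X2 : topologicalType)
    (H1 : set (homeo X1 X1)) (H2 : set (homeo X2 X2))
    (a : homeo X1 X1 -> homeo X2 X2) (b : homeo X2 X2 -> homeo X1 X1) :
  subgroup_iso H1 H2 a b -> rubin_action H1 -> rubin_action H2 ->
  exists F : homeo X1 X2, forall g x, H1 g -> F (g x) = a g (F x).
Proof.
move=> ab r1 r2; have ba := subgroup_iso_sym ab.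
have [F xF] := choice (corresponds_exists ab r1 r2).
have [F' yF'] := choice (corresponds_exists ba r2 r1).
have FK : cancel F F'.
  by move=> x; rewrite -(corresponds_cancel ab r1 r2 (xF x) (yF' (F x))).
have F'K : cancel F' F.
  by move=> y; rewrite -(corresponds_cancel ba r2 r1 (yF' y) (xF (F' y))).
exists (Homeo FK F'K (corresponds_continuous ab r1 r2 xF)
  (corresponds_continuous ba r2 r1 yF')) => g x Hg /=.
have := corresponds_sym ab r1 r2 (corresponds_equivariant ab (xF x) Hg).
by move=> /(corresponds_cancel ba r2 r1)/(_ (xF (g x))) ->.
Qed.

(** * Full groups of Cantor minimal systems *)

Section orbits.
Context {X : topologicalType} (phi : homeo X X).

Lemma zexpgS (G : groupType) (g : G) (n : int) :
  zexpg g (n + 1)%R = g * zexpg g n.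
Proof.
case: n => [n|[|n]]; first by rewrite -PoszD addn1 /= expgS.
  by rewrite /= mulgV.
have -> : (Negz n.+1 + 1)%R = Negz n.
  by rewrite !NegzE -[n.+2]addn1 PoszD GRing.opprD GRing.addrNK.
by rewrite /= [g ^+ n.+2]expgSr invgM mulVKg.
Qed.

Lemma zexpgD (G : groupType) (g : G) (m n : int) :
  zexpg g (m + n)%R = zexpg g m * zexpg g n.
Proof.
elim/int_ind: m => [|m IHm|m IHm]; first by rewrite GRing.add0r mul1g.
  by rewrite -addn1 PoszD GRing.addrAC !zexpgS IHm mulgA.
apply: (@mulgI _ g); rewrite mulgA -!zexpgS GRing.addrAC.
have -> : (- Posz m.+1 + 1)%R = (- Posz m)%R.
  by rewrite -addn1 PoszD GRing.opprD GRing.addrNK.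
exact: IHm.
Qed.

Lemma orbit_refl x : homeo_orbit phi x x.
Proof. by exists 0%R. Qed.

Lemma orbit_trans x y z :
  homeo_orbit phi x y -> homeo_orbit phi y z -> homeo_orbit phi x z.
Proof. by move=> [m _ <-] [n _ <-]; exists (n + m)%R => //; rewrite zexpgD. Qed.

Lemma orbit_sym x y : homeo_orbit phi x y -> homeo_orbit phi y x.
Proof.
move=> [n _ <-]; exists (- n)%R => //.
rewrite -[LHS]/((zexpg phi (- n)%R * zexpg phi n) x) -zexpgD.
by rewrite GRing.addNr.
Qed.

Lemma full_group_subgroup : subgroup (full_group phi).
Proof.
split=> [x|f g Hf Hg x|f Hf x]; first exact: orbit_refl.
  exact: orbit_trans (Hg x) (Hf (g x)).
by apply: orbit_sym; rewrite -{2}(homeo_mulVK f x).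
Qed.

End orbits.

Section commutator_subgroup_theory.
Context {G : groupType}.
Implicit Types A H : set G.

Lemma generated_subgroup_subgroup A : subgroup (generated_subgroup A).
Proof.
split=> [H [sH _]|x y Ax Ay H [sH AH]|x Ax H [sH AH]]; first exact: subgroup1.
  by apply: subgroupM => //; [exact: Ax|exact: Ay].
by apply: subgroupV => //; exact: Ax.
Qed.

Lemma commutator_subgroup_subgroup A : subgroup (commutator_subgroup A).
Proof. exact: generated_subgroup_subgroup. Qed.

Lemma commutator_subgroup_min A H : subgroup H ->
    (forall f g, A f -> A g -> H (f * g * f^-1 * g^-1)) ->
  commutator_subgroup A `<=` H.
Proof.
by move=> sH AH; apply: smallest_sub => // _ [f Af [g Ag <-]]; exact: AH.
Qed.

Lemma commutator_in A f g : A f -> A g ->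
  commutator_subgroup A (f * g * f^-1 * g^-1).
Proof.
by move=> Af Ag; apply: sub_gen_smallest; exists f => //; exists g.
Qed.

Lemma commutator_subgroup_subset A : subgroup A -> commutator_subgroup A `<=` A.
Proof.
move=> sA; apply: commutator_subgroup_min => // f g Af Ag.
by do !apply: (subgroupM sA) => //; exact: subgroupV.
Qed.

End commutator_subgroup_theory.

Section swap.
Context {X : topologicalType} (psi : homeo X X) (A : set X).
Hypothesis clopenA : clopen A.
Hypothesis disjA : forall z, A z -> ~ A (psi z).

Definition swap_fun (z : X) : X :=
  if pselect (A z) then psi z
  else if pselect (A (psi^-1 z)) then psi^-1 z else z.

Lemma swap_funL z : A z -> swap_fun z = psi z.
Proof. by rewrite /swap_fun; case: pselect. Qed.

Lemma swap_funR z : A (psi^-1 z) -> swap_fun z = psi^-1 z.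
Proof.
rewrite /swap_fun => Az; case: pselect => [A'|?]; last by case: pselect.
by case: (disjA Az); rewrite homeo_mulVK.
Qed.

Lemma swap_fun_id z : ~ A z -> ~ A (psi^-1 z) -> swap_fun z = z.
Proof. by rewrite /swap_fun; case: pselect => // ?; case: pselect. Qed.

Lemma swap_funK : involutive swap_fun.
Proof.
move=> z; have [Az|nAz] := pselect (A z).
  by rewrite (swap_funL Az) swap_funR homeo_mulKV.
have [Az|nAz'] := pselect (A (psi^-1 z)); last by rewrite !swap_fun_id.
by rewrite (swap_funR Az) swap_funL // homeo_mulVK.
Qed.

Lemma swap_fun_continuous : continuous swap_fun.
Proof.
have [oA cA] := clopenA; have oA' := closed_openC cA.
have local (h : homeo X X) (U : set X) z : open U -> U z ->
    (forall w, U w -> swap_fun w = h w) -> {for z, continuous swap_fun}.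
  move=> oU Uz hU B; rewrite hU // => /(homeo_continuous h) hB.
  apply: (@filterS _ (nbhs z) _ (U `&` h @^-1` B)) => [w [Uw hw]|].
    by rewrite /preimage /mkset hU.
  by apply: filterI => //; exact: open_nbhs_nbhs.
move=> z; have [Az|nAz] := pselect (A z).
  by apply: (local psi A) => //; exact: swap_funL.
have [Az|nAz'] := pselect (A (psi^-1 z)).
  apply: (local (psi^-1)%g ((psi^-1)%g @^-1` A)) => //; last exact: swap_funR.
  exact: homeo_preimage_open.
apply: (local 1 (~` A `&` (psi^-1)%g @^-1` ~` A)) => // [|w []].
  by apply: openI => //; exact: homeo_preimage_open.
exact: swap_fun_id.
Qed.

Definition swap : homeo X X :=
  Homeo swap_funK swap_funK swap_fun_continuous swap_fun_continuous.

Lemma moved_swap : moved swap `<=` A `|` (psi^-1)%g @^-1` A.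
Proof.
move=> z; apply: contraPP => /not_orP [nA nA']; apply/negP.
by rewrite negbK; apply/eqP; exact: swap_fun_id.
Qed.

End swap.

Section full_group_minimal.
Context {X : topologicalType} (phi : homeo X X).
Hypothesis hausX : hausdorff_space X.
Hypothesis zdX : zero_dimensional X.
Hypothesis compactX : compact [set: X].
Hypothesis perfectX : isolated [set: X] = set0.
Hypothesis minphi : forall x, dense (homeo_orbit phi x).

(** With y = psi x for a power psi of phi, exchange a small clopen neighbourhood
of x with its image by psi. *)
Lemma full_group_swap V x y : open V -> V x -> V y -> x != y ->
    homeo_orbit phi x y ->
  exists s, [/\ full_group phi s, moved s `<=` V, s x = y & s y = x].
Proof.
move=> oV Vx Vy xy [n _]; set psi := zexpg phi n => psix.
have mx : moved psi x by rewrite /moved /= psix eq_sym.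
have [W [oW Wx Wpsi]] := moved_separation hausX mx.
have NW : nbhs x (V `&` psi @^-1` V `&` W).
  apply: open_nbhs_nbhs; split; last by split=> //; split=> //; rewrite /= psix.
  by do 2!apply: openI => //; exact: homeo_preimage_open.
have [A [Ax clA] AN] := zero_dimensional_cvg hausX zdX compactX NW.
have disjA z : A z -> ~ A (psi z).
  by move=> /AN [_ Wz] /AN [_]; exact: Wpsi.
have psiVy : psi^-1 y = x by rewrite -psix homeo_mulKV.
exists (swap clA disjA); split.
- move=> z; change (homeo_orbit phi z (swap_fun psi A z)).
  have [Az|nAz] := pselect (A z); first by rewrite swap_funL //; exists n.
  have [Az|nAz'] := pselect (A (psi^-1 z)).
    rewrite swap_funR //; apply: orbit_sym; exists n => //.
    exact: homeo_mulVK.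
  by rewrite swap_fun_id //; exact: orbit_refl.
- move=> z /moved_swap [/AN [[]] //|/AN [[_]]].
  by rewrite /= homeo_mulVK.
- by rewrite -psix; exact: swap_funL.
- by rewrite -[LHS]/(swap_fun psi A y) swap_funR ?psiVy.
Qed.

(** If s exchanges x and y and fixes z while t exchanges x and z and fixes y,
their commutator permutes x, y and z cyclically; it sends x to y. *)
Lemma commutator_locally_transitive V x y : open V -> V x -> V y ->
    homeo_orbit phi x y ->
  exists g, [/\ commutator_subgroup (full_group phi) g, moved g `<=` V &
    g x = y].
Proof.
move=> oV Vx Vy xy; have [->|neqxy] := eqVneq x y.
  exists 1; split=> //; last exact: moved1.
  exact: subgroup1 (commutator_subgroup_subgroup _).
have [|z [[[Vz zx] zy] xz]] :=
    minphi x _ (open_setD1 hausX y (open_setD1 hausX x oV)).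
  apply: (perfect_open perfectX); first exact: open_setD1.
  by apply: (perfect_open perfectX) => //; exists x.
have xz' : x != z by apply/eqP => /esym.
have [|||s [Fs sV sx sy]] := @full_group_swap (V `\ z) x y _ _ _ neqxy xy.
- exact: open_setD1.
- by split=> //; exact/eqP.
- by split=> // /esym.
have [|||t [Ft tV tx tz]] := @full_group_swap (V `\ y) x z _ _ _ xz' xz.
- exact: open_setD1.
- by split=> //; exact/eqP.
- by split.
have sz : s z = z by apply: (unmoved sV) => -[_]; exact.
exists (s * t * s^-1 * t^-1); split.
- exact: commutator_in.
- have [sV' tV'] := (subset_trans sV (@subDsetl _ _ _),
    subset_trans tV (@subDsetl _ _ _)).
  by do !apply: movedM; rewrite ?movedV.
- rewrite -[LHS]/(s (t (s^-1 (t^-1 x)))) -{1}tz homeo_mulKV.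
  by rewrite -{1}sz homeo_mulKV tz.
Qed.

Lemma commutator_rubin_action :
  rubin_action (commutator_subgroup (full_group phi)).
Proof.
split=> // V W x oV Vx oW W0 WV.
have [y [Wy xy]] := minphi x W0 oW.
have [g [Dg gV gx]] := commutator_locally_transitive oV Vx (WV _ Wy) xy.
by exists g; rewrite gx.
Qed.

Lemma commutator_orbit x y : homeo_orbit phi x y <->
  exists2 g, commutator_subgroup (full_group phi) g & g x = y.
Proof.
split=> [xy|[g Dg <-]]; last first.
  exact: (commutator_subgroup_subset (full_group_subgroup phi) Dg).
by have [g [Dg _ gx]] := commutator_locally_transitive openT I I xy; exists g.
Qed.

End full_group_minimal.

(** * Orbit equivalences conjugate full groups *)

Section conjugation.
Context {X1 X2 : topologicalType}.

Definition homeo_flip (F : homeo X1 X2) : homeo X2 X1 :=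
  Homeo (homeo_invK F) (homeoK F) (homeo_inv_continuous F)
    (homeo_continuous F).

Lemma homeo_conj_continuous (F : homeo X1 X2) (g : homeo X1 X1) :
  continuous (F \o g \o homeo_inv F).
Proof.
move=> y; apply: continuous_comp; first exact: homeo_inv_continuous.
by apply: continuous_comp; exact: homeo_continuous.
Qed.

Definition homeo_conj (F : homeo X1 X2) (g : homeo X1 X1) : homeo X2 X2 :=
  @Homeo X2 X2 (F \o g \o homeo_inv F) (F \o (g^-1)%g \o homeo_inv F)
    (can_comp (can_comp (homeoK F) (homeoK g)) (homeo_invK F))
    (can_comp (can_comp (homeoK F) (homeo_invK g)) (homeo_invK F))
    (@homeo_conj_continuous F g) (@homeo_conj_continuous F (g^-1)%g).

Lemma homeo_conjM F g h :
  homeo_conj F (g * h) = homeo_conj F g * homeo_conj F h.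
Proof.
apply: homeoP => y.
by rewrite -[RHS]/(F (g (homeo_inv F (F (h (homeo_inv F y)))))) homeoK.
Qed.

Lemma homeo_conjV F g : homeo_conj F g^-1 = (homeo_conj F g)^-1.
Proof. exact: homeoP. Qed.

Lemma homeo_conj1 F : homeo_conj F 1 = 1.
Proof. by apply: homeoP => y; exact: homeo_invK. Qed.

Lemma commutator_full_group_conj (phi1 : homeo X1 X1) (phi2 : homeo X2 X2)
    (F : homeo X1 X2) g :
  (forall x, F @` homeo_orbit phi1 x = homeo_orbit phi2 (F x)) ->
  commutator_subgroup (full_group phi1) g ->
  commutator_subgroup (full_group phi2) (homeo_conj F g).
Proof.
move=> Forb.
have fullF h : full_group phi1 h -> full_group phi2 (homeo_conj F h).
  move=> Fh y; rewrite -{1}(homeo_invK F y) -Forb.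
  by exists (h (homeo_inv F y)).
have sD := commutator_subgroup_subgroup (full_group phi2).
apply: (@commutator_subgroup_min _ _
  (homeo_conj F @^-1` commutator_subgroup (full_group phi2))).
  split=> [|f h Df Dh|f Df].
  - by rewrite /preimage /mkset homeo_conj1; exact: subgroup1 sD.
  - by rewrite /preimage /mkset homeo_conjM; exact: (subgroupM sD).
  - by rewrite /preimage /mkset homeo_conjV; exact: (subgroupV sD).
move=> f h Ff Fh; rewrite /preimage /mkset !homeo_conjM !homeo_conjV.
by apply: commutator_in; exact: fullF.
Qed.

End conjugation.

Lemma homeo_conjK (X1 X2 : topologicalType) (F : homeo X1 X2) :
  cancel (homeo_conj F) (homeo_conj (homeo_flip F)).
Proof. by move=> g; apply: homeoP => x /=; rewrite !homeoK. Qed.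

Lemma homeo_conj_flipK (X1 X2 : topologicalType) (F : homeo X1 X2) :
  cancel (homeo_conj (homeo_flip F)) (homeo_conj F).
Proof. by move=> g; apply: homeoP => x /=; rewrite !homeo_invK. Qed.

Lemma isomorphic_subgroup_iso (G1 G2 : groupType) (H1 : set G1) (H2 : set G2) :
  subgroup H1 -> subgroup H2 -> isomorphic_subgroups H1 H2 ->
  exists a b, subgroup_iso H1 H2 a b.
Proof.
move=> s1 s2 [a [[aH ainj asurj] aM]].
have bex y : exists x, H2 y -> H1 x /\ a x = y.
  have [Hy|nHy] := pselect (H2 y); last by exists 1.
  by have [x Hx xy] := asurj _ Hy; exists x.
have [b bP] := choice bex.
exists a, b; split=> // [y /bP[]|x Hx|y /bP[]] //.
have [Hb ab] := bP _ (aH _ Hx).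
by apply: ainj; rewrite ?inE.
Qed.

Theorem theorem5p2 (R : realType) (X1 X2 : metricType R)
    (phi1 : homeo X1 X1) (phi2 : homeo X2 X2)
    (hphi1 : cantor_minimal_system phi1)
    (hphi2 : cantor_minimal_system phi2) :
  orbit_equivalent phi1 phi2 <->
  isomorphic_subgroups (commutator_subgroup (full_group phi1))
                       (commutator_subgroup (full_group phi2)).
Proof.
have [[_ zd1 c1 p1] m1] := hphi1; have [[_ zd2 c2 p2] m2] := hphi2.
have [hd1 hd2] := (@metric_hausdorff _ X1, @metric_hausdorff _ X2).
split=> [[F Forb]|iso].
  have Forb' y : homeo_flip F @` homeo_orbit phi2 y =
      homeo_orbit phi1 (homeo_flip F y).
    rewrite -{1}(homeo_invK F y) -Forb image_comp.
    rewrite (_ : _ \o _ = id) ?image_id //.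
    by apply: funext => x; exact: homeoK.
  exists (homeo_conj F); split=> [|x y _ _]; last exact: homeo_conjM.
  split=> [g Dg|f g _ _|g Dg].
  - exact: commutator_full_group_conj Forb Dg.
  - exact: (can_inj (homeo_conjK F)).
  - exists (homeo_conj (homeo_flip F) g); last exact: homeo_conj_flipK.
    exact: commutator_full_group_conj Forb' Dg.
have [a [b ab]] := isomorphic_subgroup_iso
  (commutator_subgroup_subgroup _) (commutator_subgroup_subgroup _) iso.
have r1 := commutator_rubin_action hd1 zd1 c1 p1 m1.
have r2 := commutator_rubin_action hd2 zd2 c2 p2 m2.
have [F FE] := rubin_reconstruction ab r1 r2; exists F => x.
apply/seteqP; split=> [_ [z /commutator_orbit xz <-]|y].
  have [//|//|//|//|//|g Dg <-] := xz.
  rewrite FE //; apply/commutator_orbit => //.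
  by exists (a g) => //; exact: (iso_fun ab).
move=> /commutator_orbit [//|//|//|//|//|g Dg <-].
exists (b g x); last by rewrite FE ?(iso_invK ab) //; exact: (iso_inv ab).
by apply/commutator_orbit => //; exists (b g) => //; exact: (iso_inv ab).
Qed.
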